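(* Let $\Omega$ be a finite set of candidate impressions, $\mathcal{D}_{\mathrm{val}}$ a finite set of validation samples, $g(v)\in\mathbb{R}^d$ a vector for each $v\in\Omega\cup\mathcal{D}_{\mathrm{val}}$, $\hat\sigma:\Omega\to[0,1]$ a function, $\lambda>0$ and $\beta\in[0,1]$. For $S\subseteq\Omega$ define $$U(S):=\sum_{x\in\mathcal{D}_{\mathrm{val}}}\max_{z\in S}\exp\big(-\lambda\|g(x)-g(z)\|^2\big),\qquad V(S):=\sum_{z\in S}\hat\sigma(z),$$ $$F(S):=(1-\beta)\,U(S)+\beta\,V(S),$$ where the maximum over the empty set is $0$. Then $F:2^{\Omega}\to\mathbb{R}_{\ge 0}$ is a submodular function, i.e. for all $A\subseteq B\subseteq\Omega$ and $v\in\Omega\setminus B$, $$F(A\cup\{v\})-F(A)\;\ge\;F(B\cup\{v\})-F(B).$$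
   Context: $g(v)$ denotes the gradient of a model's loss function at data point $v$, evaluated at a fixed model parameter $\theta_0$; $\hat\sigma(z)$ is the predicted click-through rate (a probability) of impression $z$. $\|\cdot\|$ is the Euclidean norm. $U$ is the gradient-coverage surrogate for uncertainty reduction, $V$ the immediate value, and $F$ the composite utility. *)

(* Defs.v *)
From mathcomp Require Export all_boot all_order all_algebra finmap.
From mathcomp Require Export reals sequences exp.

Set Implicit Arguments.
Unset Strict Implicit.
Unset Printing Implicit Defensive.

Import Order.TTheory GRing.Theory Num.Theory.

Local Open Scope ring_scope.
Local Open Scope fset_scope.

(* The library norm `|u| on row vectors is the sup norm, hence this one. *)
Definition enorm (R : realType) (d : nat) (u : 'rV[R]_d) : R :=
  Num.sqrt (\sum_(i < d) u ord0 i ^+ 2).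

(* T is the ambient type of data points; impressions and validation samples
   are finite subsets of it, which may overlap. *)
Section Utility.
Variables (R : realType) (T : choiceType) (d : nat).
Implicit Types (Dval S : {fset T}) (g : T -> 'rV[R]_d) (sigma : T -> R).

(* The big operator starts from 0: this is the value on the empty set, and it
   does not affect the maximum otherwise, since exponentials are positive. *)
Definition coverage Dval g (lambda : R) S : R :=
  \sum_(x <- Dval)
    \big[Num.max/0]_(z <- S) expR (- lambda * enorm (g x - g z) ^+ 2).

Definition immediate_value sigma S : R := \sum_(z <- S) sigma z.

Definition utility Dval g sigma (lambda beta : R) S : R :=
  (1 - beta) * coverage Dval g lambda S + beta * immediate_value sigma S.

Definition submodular (Omega : {fset T}) (F : {fset T} -> R) : Prop :=
  forall A B : {fset T}, A `<=` B -> B `<=` Omega ->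
  forall v : T, v \in Omega `\` B ->
    F (A `|` [fset v]) - F A >= F (B `|` [fset v]) - F B.

End Utility.

(* Main.v *)
(* A maximum over a finite set has diminishing returns: adding v replaces
   the current value m by max(m, f v), and t |-> max(t, f v) - t is
   nonincreasing. The modular term contributes equally to both sides. *)
Require Import Defs.
From mathcomp Require Import ring.
Import Order.TTheory GRing.Theory Num.Theory.

Local Open Scope ring_scope.
Local Open Scope fset_scope.

(** Each side bounds the other. Since max is idempotent, [v] may already lie in [S], in contrast
    with the sum in [gainF] below. *)
Lemma bigmax_fsetU1 (disp : Order.disp_t) (R : orderType disp) (T : choiceType)
    (x0 : R) (f : T -> R) (S : {fset T}) (v : T) :
  \big[Order.max/x0]_(z <- S `|` [fset v]) f z =
  Order.max (\big[Order.max/x0]_(z <- S) f z) (f v).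
Proof.
apply/le_anti/andP; split.
  rewrite big_seq; apply: bigmax_le; first by rewrite le_max bigmax_ge_id.
  move=> z; rewrite in_fsetU in_fset1 => /orP[zS|/eqP->]; rewrite le_max.
    by rewrite le_bigmax_seq.
  by rewrite lexx orbT.
rewrite ge_max; apply/andP; split.
  by apply: sub_bigmax_seq => z zS; rewrite in_fsetU zS.
by apply: le_bigmax_seq; rewrite // in_fsetU in_fset1 eqxx orbT.
Qed.

(** Subtracting inside the maximum turns the gain at [t] into [max(0, c - t)], which is antitone in
    [t]. *)
Lemma maxr_gain_antimono (R : realDomainType) (a b c : R) :
  a <= b -> Num.max b c - b <= Num.max a c - a.
Proof.
move=> ab; rewrite !addr_maxl !subrr.
by rewrite ge_max !le_max lexx /= lerB ?orbT.
Qed.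

Theorem theorem2 (R : realType) (T : choiceType) (d : nat)
    (Omega Dval : {fset T}) (g : T -> 'rV[R]_d) (sigma : T -> R)
    (lambda beta : R)
    (hsigma : forall z, z \in Omega -> 0 <= sigma z <= 1)
    (hlambda : 0 < lambda)
    (hbeta : 0 <= beta <= 1) :
  (forall S : {fset T}, S `<=` Omega ->
     0 <= utility Dval g sigma lambda beta S) /\
  submodular Omega (utility Dval g sigma lambda beta).
Proof.
have /andP[beta_ge0 beta_le1] := hbeta.
have beta'_ge0 : 0 <= 1 - beta by rewrite subr_ge0.
split=> [S SO | A B AB BO v].
  rewrite addr_ge0 ?mulr_ge0 //.
    (* Each maximum starts from 0, so it is nonnegative even for empty [S]. *)
    by rewrite sumr_ge0 // => x _; exact: bigmax_ge_id.
  rewrite /immediate_value big_seq sumr_ge0 // => z zS.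
  by have /andP[] := hsigma z (fsubsetP SO z zS).
rewrite in_fsetD => /andP[vB _].
have vA : v \notin A by apply: contra vB; exact: (fsubsetP AB).
(* Freshness of [v] makes the sum grow by exactly [sigma v], a term free of [S] that cancels between
   [A] and [B]. *)
have gainF (S : {fset T}) : v \notin S ->
    utility Dval g sigma lambda beta (S `|` [fset v])
      - utility Dval g sigma lambda beta S =
    ((1 - beta) * (coverage Dval g lambda (S `|` [fset v])
      - coverage Dval g lambda S) + beta * sigma v)%R.
  move=> vS; rewrite /utility /immediate_value fsetUC big_fsetU1 //=; ring.
rewrite !gainF // lerD2r; apply: ler_wpM2l => //.
(* The coverage gains are compared one validation sample at a time. *)
rewrite /coverage -!sumrB; apply: ler_sum => x _; rewrite !bigmax_fsetU1.
(* The current maximum over [A] is at most the one over [B], as [A] is included in [B]. *)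
apply: maxr_gain_antimono; apply: sub_bigmax_seq; exact/fsubsetP.
Qed.
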